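(* Let $r$ be a nonnegative integer. For every integer $n\ge 0$, \[ H_n(x)=\frac{1}{2^r}\sum_{k=0}^{n}\binom{n}{k}2^k\left[\sum_{j=0}^{r}\binom{r}{j}H_{n-k}(j)\right]E_k^{(r)}(x). \]
   Context: The Hermite polynomials $H_n(x)$ are defined by $e^{2xt-t^2}=\sum_{n\ge0}H_n(x)\frac{t^n}{n!}$. The Euler polynomials of order $r$ are defined by $\left(\frac{2}{e^t+1}\right)^r e^{xt}=\sum_{n\ge0}E_n^{(r)}(x)\frac{t^n}{n!}$. *)

(* Defs.v *)
From HB Require Import structures.
From mathcomp Require Import all_boot all_order all_algebra.
From mathcomp Require Import boolp.

Set Implicit Arguments.
Unset Strict Implicit.
Unset Printing Implicit Defensive.

Import GRing.Theory Num.Theory.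
Local Open Scope ring_scope.

Record fps (A : Type) := FPS { fcoef : nat -> A }.

Lemma fpsP (A : Type) (f g : fps A) : fcoef f =1 fcoef g -> f = g.
Proof. by case: f g => [f] [g] /= /funext ->. Qed.

HB.instance Definition _ (A : Type) := gen_eqMixin (fps A).
HB.instance Definition _ (A : Type) := gen_choiceMixin (fps A).

Section Zmodule.
Variable A : zmodType.
Implicit Types f g h : fps A.

Definition fps_zero : fps A := FPS (fun=> 0).
Definition fps_opp f : fps A := FPS (fun n => - fcoef f n).
Definition fps_add f g : fps A := FPS (fun n => fcoef f n + fcoef g n).

Lemma fps_addA : associative fps_add.
Proof. by move=> f g h; apply: fpsP => n /=; rewrite addrA. Qed.
Lemma fps_addC : commutative fps_add.
Proof. by move=> f g; apply: fpsP => n /=; rewrite addrC. Qed.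
Lemma fps_add0 : left_id fps_zero fps_add.
Proof. by move=> f; apply: fpsP => n /=; rewrite add0r. Qed.
Lemma fps_addN : left_inverse fps_zero fps_opp fps_add.
Proof. by move=> f; apply: fpsP => n /=; rewrite addNr. Qed.

HB.instance Definition _ :=
  GRing.isZmodule.Build (fps A) fps_addA fps_addC fps_add0 fps_addN.
End Zmodule.

Section ComRing.
Variable A : comNzRingType.
Implicit Types f g h : fps A.

Definition fpsC (c : A) : fps A := FPS (fun n => if n == 0%N then c else 0).
Definition fpsX : fps A := FPS (fun n => (n == 1%N)%:R).

Definition fps_mul f g : fps A :=
  FPS (fun n => \sum_(i < n.+1) fcoef f i * fcoef g (n - i)).

Definition fps_trunc N f : {poly A} := \poly_(i < N.+1) fcoef f i.

Lemma fcoef_mulE N n f g : (n <= N)%N ->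
  fcoef (fps_mul f g) n = (fps_trunc N f * fps_trunc N g)`_n.
Proof.
move=> nN; rewrite coefM; apply: eq_bigr => i _.
have iN : (i <= N)%N by rewrite (leq_trans _ nN) // -ltnS.
by rewrite /fps_trunc !coef_poly !ltnS iN (leq_trans (leq_subr i n) nN).
Qed.

Lemma fps_mulC : commutative fps_mul.
Proof.
by move=> f g; apply: fpsP => n; rewrite !(fcoef_mulE _ _ (leqnn n)) mulrC.
Qed.

Lemma fps_mulA : associative fps_mul.
Proof.
move=> f g h; apply: fpsP => n.
transitivity (fps_trunc n f * (fps_trunc n g * fps_trunc n h))`_n.
  rewrite coefM; apply: eq_bigr => i _.
  have iN : (i <= n)%N by rewrite -ltnS.
  by rewrite -(fcoef_mulE _ _ (leq_subr i n)) coef_poly ltnS iN.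
rewrite mulrA coefM; apply: eq_bigr => i _.
have iN : (i <= n)%N by rewrite -ltnS.
by rewrite -(fcoef_mulE _ _ iN) coef_poly ltnS leq_subr.
Qed.

Lemma fps_mul1 : left_id (fpsC 1) fps_mul.
Proof.
move=> f; apply: fpsP => n /=.
by rewrite big_ord_recl /= mul1r subn0 big1 ?addr0 // => i _; rewrite mul0r.
Qed.

Lemma fps_mulD : left_distributive fps_mul +%R.
Proof.
move=> f g h; apply: fpsP => n /=.
by rewrite -big_split /=; apply: eq_bigr => i _; rewrite mulrDl.
Qed.

Lemma fps_one_neq0 : fpsC 1 != 0.
Proof.
apply/eqP => /(congr1 (fun f => fcoef f 0)) /= /eqP.
by rewrite oner_eq0.
Qed.

HB.instance Definition _ := GRing.Zmodule_isComNzRing.Build (fps A)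
  fps_mulA fps_mulC fps_mul1 fps_mulD fps_one_neq0.

Lemma fcoefB f g n : fcoef (f - g) n = fcoef f n - fcoef g n.
Proof. by []. Qed.

Lemma fcoefM f g n :
  fcoef (f * g) n = \sum_(i < n.+1) fcoef f i * fcoef g (n - i).
Proof. by []. Qed.

Lemma fcoef1 n : fcoef (1 : fps A) n = (n == 0%N)%:R.
Proof. by rewrite /=; case: (n == 0%N). Qed.

Lemma fcoef_sum (I : Type) (s : seq I) (P : pred I) (F : I -> fps A) n :
  fcoef (\sum_(i <- s | P i) F i) n = \sum_(i <- s | P i) fcoef (F i) n.
Proof. by apply: (big_morph (fun f => fcoef f n)). Qed.

Lemma fcoef_exp_small f k n :
  fcoef f 0 = 0 -> (n < k)%N -> fcoef (f ^+ k) n = 0.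
Proof.
move=> f0; elim: k n => // k IHk n; rewrite ltnS => nk.
rewrite exprS fcoefM big1 // => -[[|i] /= lti] _; first by rewrite f0 mul0r.
by rewrite IHk ?mulr0 // (leq_trans _ nk) // -subSn // subSS leq_subr.
Qed.

(* Sum of the f ^+ k over all k; meaningful when f has no constant term, since
   f ^+ k then only contributes in degrees at least k.                        *)
Definition fps_geom f : fps A :=
  FPS (fun n => \sum_(k < n.+1) fcoef (f ^+ k) n).

Lemma fps_geomP f : fcoef f 0 = 0 -> (1 - f) * fps_geom f = 1.
Proof.
move=> f0; apply: fpsP => n.
transitivity (fcoef ((1 - f) * \sum_(k < n.+1) f ^+ k) n).
  rewrite !fcoefM; apply: eq_bigr => i _; congr (_ * _).
  rewrite fcoef_sum /= (big_ord_widen n.+1 (fun k => fcoef (f ^+ k) (n - i)));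
    last by rewrite ltnS leq_subr.
  rewrite [RHS](bigID (fun k : 'I_n.+1 => k < (n - i).+1)%N) /=.
  rewrite [X in _ = _ + X]big1 ?addr0 // => k; rewrite -leqNgt => ltk.
  exact: fcoef_exp_small.
have -> : (1 - f) * (\sum_(k < n.+1) f ^+ k) = 1 - f ^+ n.+1.
  by rewrite -opprB mulNr -subrX1 opprB.
by rewrite fcoefB fcoef_exp_small ?subr0.
Qed.
End ComRing.

Section ComUnitRing.
Variable A : comUnitRingType.
Implicit Types f g : fps A.

Definition fps_unit : {pred fps A} := [pred f | fcoef f 0 \is a GRing.unit].

Definition fps_inv f : fps A :=
  if f \in fps_unit then
    let c := fpsC (fcoef f 0)^-1 in c * fps_geom (1 - c * f)
  else f.

Lemma fcoefM0 f g : fcoef (f * g) 0 = fcoef f 0 * fcoef g 0.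
Proof. by rewrite fcoefM big_ord1. Qed.

Lemma fps_mulV : {in fps_unit, left_inverse 1 fps_inv *%R}.
Proof.
move=> f fU; rewrite /fps_inv fU mulrC mulrA [f * _]mulrC.
set u := _ * f; rewrite -[u in u * _](subKr 1) fps_geomP //.
by rewrite fcoefB fcoefM0 /= mulVr ?subrr.
Qed.

Lemma fps_unitPl f g : g * f = 1 -> fps_unit f.
Proof.
move=> /(congr1 (fun h => fcoef h 0)); rewrite fcoefM0 /= => gf1.
by apply/unitrP; exists (fcoef g 0); split=> //; rewrite mulrC.
Qed.

Lemma fps_inv_out : {in [predC fps_unit], fps_inv =1 id}.
Proof. by move=> f; rewrite inE /= /fps_inv => /negbTE ->. Qed.

HB.instance Definition _ := GRing.ComNzRing_hasMulInverse.Build (fps A)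
  fps_mulV fps_unitPl fps_inv_out.

(* exp f = \sum_k f ^+ k / k! for f without constant term; as for fps_geom, the
   terms with k > n vanish in degree n.                                       *)
Definition fps_exp f : fps A :=
  FPS (fun n => \sum_(k < n.+1) fcoef (f ^+ k) n / k`!%:R).

Definition egf (a : nat -> A) : fps A := FPS (fun n => a n / n`!%:R).

Definition egf_seq f (n : nat) : A := fcoef f n * n`!%:R.

Lemma egf_seqK f :
  (forall n, n`!%:R \is a @GRing.unit A) -> egf (egf_seq f) = f.
Proof. by move=> factU; apply: fpsP => n /=; rewrite /egf_seq mulrK. Qed.
End ComUnitRing.

Section HermiteEuler.
Variable F : numFieldType.

(* The variable x is the indeterminate 'X of the coefficient ring {poly F}. *)
Let x : fps {poly F} := fpsC 'X.
Let t : fps {poly F} := fpsX {poly F}.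

Definition hermite_gf : fps {poly F} := fps_exp (2 * x * t - t ^+ 2).
Definition hermite (n : nat) : {poly F} := egf_seq hermite_gf n.

Definition euler_gf (r : nat) : fps {poly F} :=
  (2 / (fps_exp t + 1)) ^+ r * fps_exp (x * t).
Definition euler (r n : nat) : {poly F} := egf_seq (euler_gf r) n.

Lemma polyC_fact_unit n : n`!%:R \is a @GRing.unit {poly F}.
Proof. by rewrite -polyC_natr poly_unitE size_polyC coefC eqxx unitfE
  pnatr_eq0 -lt0n fact_gt0. Qed.

Lemma hermiteP : fps_exp (2 * x * t - t ^+ 2) = egf hermite.
Proof. by rewrite egf_seqK //; exact: polyC_fact_unit. Qed.

Lemma eulerP r : (2 / (fps_exp t + 1)) ^+ r * fps_exp (x * t) = egf (euler r).
Proof. by rewrite egf_seqK //; exact: polyC_fact_unit. Qed.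

(* Inversion is the identity on non-units, so euler_gf relies on this. *)
Lemma fps_exp_add1_unit : fps_exp t + 1 \is a GRing.unit.
Proof.
change (fcoef (fps_exp t) 0 + 1 \is a @GRing.unit {poly F}).
rewrite /= big_ord1 expr0 /= fact0 divr1.
by rewrite -(natrD _ 1 1) -polyC_natr poly_unitE size_polyC coefC eqxx unitfE
  pnatr_eq0.
Qed.

Lemma fcoef_fps_exp_X n : fcoef (fps_exp t) n = n`!%:R^-1.
Proof.
have tE k m : fcoef (t ^+ k) m = (m == k)%:R.
  elim: k m => [|k IHk] m; first by rewrite expr0 fcoef1.
  rewrite exprS fcoefM; case: m => [|m].
    by rewrite big_ord1 /= mul0r.
  rewrite !big_ord_recl big1 /=.
    by rewrite mul0r add0r mul1r addr0 IHk subSS subn0 eqSS.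
  by move=> i _; rewrite mul0r.
rewrite /= big_ord_recr /= tE eqxx mul1r big1 ?add0r // => i _.
by rewrite tE gtn_eqF ?mul0r.
Qed.
End HermiteEuler.

(* Main.v *)
(* Put E(t) = (2/(e^t+1))^r e^(xt), so that the substitution t -> 2t gives
   (e^(2t)+1)^r E(2t) = 2^r e^(2xt). As (e^(2t)+1)^r = sum_j C(r,j) e^(2jt),
   multiplying by e^(-t^2) yields
     2^r e^(2xt-t^2) = E(2t) * sum_j C(r,j) e^(2jt-t^2),
   and the theorem compares the coefficients of t^n. *)
Require Import Defs.
From HB Require Import structures.
From mathcomp Require Import all_boot all_order all_algebra.

Import GRing.Theory.
Local Open Scope ring_scope.

(** * Coefficients of multiples and of products of powers *)

Lemma fcoefMn (A : zmodType) (f : fps A) m n :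
  fcoef (f *+ m) n = fcoef f n *+ m.
Proof. by elim: m => // m IHm; rewrite !mulrS -IHm. Qed.

Section Coefficients.
Variable A : comNzRingType.
Implicit Types f g : fps A.

Lemma fcoef_fpsCM (c : A) f n : fcoef (fpsC c * f) n = c * fcoef f n.
Proof.
rewrite fcoefM big_ord_recl subn0 /= big1 ?addr0 // => i _.
by rewrite mul0r.
Qed.

(** Orders add: in each term of the Cauchy product, either [i < a] or [n - i < b]. *)
Lemma fcoef_expM_small f g a b n :
  fcoef f 0 = 0 -> fcoef g 0 = 0 -> (n < a + b)%N ->
  fcoef (f ^+ a * g ^+ b) n = 0.
Proof.
move=> f0 g0 ltn; rewrite fcoefM big1 // => i _.
have [lti|lei] := ltnP i a; first by rewrite fcoef_exp_small ?mul0r.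
rewrite (fcoef_exp_small g0) ?mulr0 // -subSn ?leq_ord // leq_subLR.
by rewrite (leq_trans ltn) // leq_add2r.
Qed.
End Coefficients.

(** * The exponential of a series without constant term *)

Section Exp.
Variable A : comUnitRingType.
Hypothesis factU : forall n, n`!%:R \is a @GRing.unit A.
Implicit Types f g : fps A.

(** [fps_exp] truncates at a point that varies with the degree; here one finite sum serves all
    degrees up to [N], so that ring identities for finite sums apply. *)
Lemma fcoef_exp_widen f N n : fcoef f 0 = 0 -> (n <= N)%N ->
  fcoef (fps_exp f) n = fcoef (\sum_(k < N.+1) fpsC (k`!%:R^-1) * f ^+ k) n.
Proof.
move=> f0 nN; rewrite fcoef_sum [LHS]/=.
rewrite (big_ord_widen N.+1 (fun k => fcoef (f ^+ k) n / k`!%:R)) //.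
rewrite [RHS](bigID (fun k : 'I_N.+1 => k < n.+1)%N).
rewrite [X in _ = _ + X]big1 ?addr0 => [|k]; last first.
  by rewrite -leqNgt => ltk; rewrite fcoef_fpsCM fcoef_exp_small ?mulr0.
by apply: eq_bigr => k _; rewrite fcoef_fpsCM mulrC.
Qed.

Lemma bin_fact_div k i : (i <= k)%N ->
  'C(k, i)%:R / k`!%:R = i`!%:R^-1 * (k - i)`!%:R^-1 :> A.
Proof.
move=> leik; apply: (canLR (mulrK (factU k))).
rewrite -(bin_fact leik) !natrM mulrCA.
by rewrite mulrACA !mulVr ?mulr1.
Qed.

(** By the binomial theorem the left side sums [G a b] over the triangle $a + b \le n$. The product
    on the right sums it over the square $a, b \le n$, where the extra terms vanish by order. *)
Lemma fps_expD f g : fcoef f 0 = 0 -> fcoef g 0 = 0 ->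
  fps_exp (f + g) = fps_exp f * fps_exp g.
Proof.
move=> f0 g0; apply: fpsP => n.
pose G a b := fcoef (f ^+ a * g ^+ b) n * (a`!%:R^-1 * b`!%:R^-1).
transitivity (\sum_(a < n.+1) \sum_(b < n.+1) G a b); last first.
  rewrite fcoefM.
  under [RHS]eq_bigr => i _.
    rewrite (fcoef_exp_widen f n) ?leq_ord //.
    rewrite (fcoef_exp_widen g n) ?leq_subr //. over.
  rewrite -fcoefM mulr_suml fcoef_sum; apply: eq_bigr => a _.
  rewrite mulr_sumr fcoef_sum; apply: eq_bigr => b _.
  by rewrite mulrACA -mulrA !fcoef_fpsCM /G mulrA mulrC.
transitivity (\sum_(k < n.+1) \sum_(a < n.+1 | (a < k.+1)%N) G a (k - a)%N).
  rewrite [LHS]/=; apply: eq_bigr => k _.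
  rewrite -(big_ord_widen _ (fun a => G a (k - a)%N)) // addrC exprDn.
  rewrite fcoef_sum mulr_suml; apply: eq_bigr => a _.
  have leak : (a <= k)%N by rewrite -ltnS.
  rewrite fcoefMn -[_ *+ 'C(_, _)]mulr_natr -mulrA bin_fact_div //.
  by rewrite [g ^+ _ * _]mulrC.
rewrite (exchange_big_dep predT) //=; apply: eq_bigr => a _.
rewrite [RHS](bigID (fun b : 'I_n.+1 => b < n.+1 - a)%N) /=.
rewrite [X in _ = _ + X]big1 ?addr0 => [|b]; last first.
  rewrite -leqNgt leq_subLR => ltb.
  by rewrite /G fcoef_expM_small ?mul0r.
rewrite -(big_ord_widen _ (fun b => G a b)) ?leq_subr //.
(* For fixed [a], the index $k \ge a$ is shifted to $b = k - a$. *)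
rewrite -(big_geq_mkord _ _ predT (fun k => G a (k - a)%N)) /=.
rewrite -{1}[nat_of_ord a]add0n big_addn big_mkord.
by apply: eq_bigr => b _; rewrite addnK.
Qed.

Lemma fps_exp0 : fps_exp (0 : fps A) = 1.
Proof.
apply: fpsP => n; rewrite [LHS]/= big_ord_recl expr0 fact0 divr1.
rewrite big1 ?addr0 // => i _.
by rewrite exprS mul0r mul0r.
Qed.

Lemma fps_expMn f m : fcoef f 0 = 0 -> fps_exp (f *+ m) = fps_exp f ^+ m.
Proof.
move=> f0; elim: m => [|m IHm]; first by rewrite fps_exp0.
by rewrite mulrS exprS -IHm fps_expD // fcoefMn f0 mul0rn.
Qed.
End Exp.

(** * The substitution $t \mapsto ct$ as a ring morphism *)

Section Scale.
Variables (A : comNzRingType) (c : A).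

Definition fps_scale (f : fps A) : fps A := FPS (fun n => c ^+ n * fcoef f n).

Lemma fcoef_scale f n : fcoef (fps_scale f) n = c ^+ n * fcoef f n.
Proof. by []. Qed.

Fact fps_scale_zmod_morphism : zmod_morphism fps_scale.
Proof. by move=> f g; apply: fpsP => n; rewrite /= mulrBr. Qed.

Fact fps_scale_monoid_morphism : monoid_morphism fps_scale.
Proof.
split=> [|f g]; apply: fpsP => n.
  by rewrite /=; case: n => [|n]; rewrite ?mulr0 ?mulr1.
rewrite /= mulr_sumr; apply: eq_bigr => i _.
by rewrite mulrACA -exprD subnKC // -ltnS.
Qed.

HB.instance Definition _ :=
  GRing.isZmodMorphism.Build _ _ fps_scale fps_scale_zmod_morphism.
HB.instance Definition _ :=
  GRing.isMonoidMorphism.Build _ _ fps_scale fps_scale_monoid_morphism.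

Lemma fps_scaleX : fps_scale (fpsX A) = fpsC c * fpsX A.
Proof.
apply: fpsP => n; rewrite fcoefM big_ord_recl subn0 /=.
rewrite big1 => [|i _]; last by rewrite mul0r.
by case: n => [|[|n]]; rewrite /= ?mulr0 ?mulr1 ?addr0.
Qed.

Lemma fps_scaleC a : fps_scale (fpsC a) = fpsC a.
Proof. by apply: fpsP => -[|n]; rewrite /= ?mul1r ?mulr0. Qed.
End Scale.

Arguments fps_scale {A} c f.

Lemma fps_scale_exp (A : comUnitRingType) (c : A) (f : fps A) :
  fps_scale c (fps_exp f) = fps_exp (fps_scale c f).
Proof.
apply: fpsP => n; rewrite /= mulr_sumr; apply: eq_bigr => k _.
by rewrite -rmorphXn /= mulrA.
Qed.

(** * Ring morphisms applied to the coefficients *)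

Section Map.
Variables (A B : comNzRingType) (phi : {rmorphism A -> B}).

Definition fps_map (f : fps A) : fps B := FPS (fun n => phi (fcoef f n)).

Fact fps_map_zmod_morphism : zmod_morphism fps_map.
Proof. by move=> f g; apply: fpsP => n; rewrite /= rmorphB. Qed.

Fact fps_map_monoid_morphism : monoid_morphism fps_map.
Proof.
split=> [|f g]; apply: fpsP => n.
  by rewrite /=; case: n => [|n]; rewrite ?rmorph0 ?rmorph1.
by rewrite /= rmorph_sum; apply: eq_bigr => i _; rewrite rmorphM.
Qed.

HB.instance Definition _ :=
  GRing.isZmodMorphism.Build _ _ fps_map fps_map_zmod_morphism.
HB.instance Definition _ :=
  GRing.isMonoidMorphism.Build _ _ fps_map fps_map_monoid_morphism.

Lemma fps_mapX : fps_map (fpsX A) = fpsX B.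
Proof. by apply: fpsP => n; rewrite /= rmorph_nat. Qed.

Lemma fps_mapC a : fps_map (fpsC a) = fpsC (phi a).
Proof. by apply: fpsP => -[|n]; rewrite /= ?rmorph0. Qed.
End Map.

Arguments fps_map {A B} phi f.

(** A ring morphism is sure to commute with division only when the divisor is a unit, hence the
    condition on factorials. *)
Lemma fps_map_exp (A B : comUnitRingType) (phi : {rmorphism A -> B})
    (f : fps A) : (forall n, n`!%:R \is a @GRing.unit A) ->
  fps_map phi (fps_exp f) = fps_exp (fps_map phi f).
Proof.
move=> factU; apply: fpsP => n; rewrite /= rmorph_sum; apply: eq_bigr => k _.
by rewrite rmorph_div //= rmorph_nat -rmorphXn.
Qed.

(* A stands for {poly F} and ev j for evaluation at j. Working over an abstract A
   avoids the two convertible but syntactically different ring structures of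
   {poly F}, whose comparison does not terminate in practice. *)
Section Identity.
Variables (A : comUnitRingType) (x : A).
Hypothesis factU : forall n, n`!%:R \is a @GRing.unit A.
Let t : fps A := fpsX A.

Definition hermite_series : fps A := fps_exp (2 * fpsC x * t - t ^+ 2).
Definition euler_series (r : nat) : fps A :=
  (2 / (fps_exp t + 1)) ^+ r * fps_exp (fpsC x * t).

Lemma fpsC_nat m : fpsC m%:R = m%:R :> fps A.
Proof.
by apply: fpsP => n; rewrite fcoefMn fcoef1; case: n => [|n] //=; rewrite mul0rn.
Qed.

Lemma fcoef0_mulX (f : fps A) : fcoef (f * t) 0 = 0.
Proof. by rewrite fcoefM0 /= mulr0. Qed.

Lemma fps_exp_add1U : fps_exp t + 1 \is a GRing.unit.
Proof.
change (fcoef (fps_exp t) 0 + 1 \is a @GRing.unit A).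
(* The constant term is $2 = 2!$, a unit by [factU]. *)
by rewrite /= big_ord1 /= fact0 divr1 -(natrD _ 1 1) (factU 2).
Qed.

Lemma fps_scale_euler_series r :
  (fps_exp (2 * t) + 1) ^+ r * fps_scale 2 (euler_series r) =
  2 ^+ r * fps_exp (2 * fpsC x * t).
Proof.
have scaleM (f g : fps A) : fps_scale 2 (f * g) = fps_scale 2 f * fps_scale 2 g.
  exact: (rmorphM (fps_scale (2 : A))).
have scale_t : fps_scale 2 t = 2 * t by rewrite fps_scaleX fpsC_nat.
have scale_exp_t : fps_scale 2 (fps_exp t) = fps_exp (2 * t).
  by rewrite fps_scale_exp scale_t.
have scale_exp_xt :
    fps_scale 2 (fps_exp (fpsC x * t)) = fps_exp (2 * fpsC x * t).
  by rewrite fps_scale_exp scaleM scale_t fps_scaleC mulrCA mulrA.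
(* This is the image under scaling of $(e^t+1) \cdot 2/(e^t+1) = 2$, which avoids transporting an
   inverse through the morphism. *)
have scale_base : (fps_exp (2 * t) + 1) * fps_scale 2 (2 / (fps_exp t + 1)) = 2.
  have <- : fps_scale 2 (fps_exp t + 1) = fps_exp (2 * t) + 1.
    by rewrite rmorphD rmorph1 /= scale_exp_t.
  rewrite -scaleM mulrC divrK ?fps_exp_add1U //.
  exact: (rmorph_nat (fps_scale 2)).
rewrite /euler_series scaleM scale_exp_xt rmorphXn mulrA.
by rewrite -(exprMn r (fps_exp (2 * t) + 1)) scale_base.
Qed.

Variable ev : nat -> {rmorphism A -> A}.
Hypothesis ev_x : forall j, ev j x = j%:R.

(** At $x = j$ the generating function becomes $e^{2jt-t^2}$; written with the power $(e^{2t})^j$,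
    it can be summed over [j] by the binomial theorem. *)
Lemma fps_map_hermite_series (j : nat) :
  fps_map (ev j) hermite_series =
  fps_exp (2 * t) ^+ j * fps_exp (- t ^+ 2).
Proof.
rewrite /hermite_series fps_map_exp // rmorphB rmorphXn !rmorphM rmorph_nat /=.
rewrite fps_mapX fps_mapC ev_x fpsC_nat mulrAC mulr_natr.
rewrite fps_expD ?fps_expMn ?fcoef0_mulX //.
- by rewrite fcoefMn fcoef0_mulX mul0rn.
- by rewrite expr2 -mulNr fcoef0_mulX.
Qed.

Lemma hermite_series_euler_series r :
  2 ^+ r * hermite_series = fps_scale 2 (euler_series r) *
    \sum_(j < r.+1) fps_map (ev j) hermite_series *+ 'C(r, j).
Proof.
under eq_bigr => j _ do rewrite fps_map_hermite_series -mulrnAl.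
rewrite -mulr_suml mulrA.
have -> : \sum_(j < r.+1) fps_exp (2 * t) ^+ j *+ 'C(r, j) =
    (fps_exp (2 * t) + 1) ^+ r.
  by rewrite addrC exprDn; apply: eq_bigr => j _; rewrite expr1n mul1r.
rewrite [X in _ = X * _]mulrC fps_scale_euler_series -mulrA.
rewrite -fps_expD ?fcoef0_mulX //.
by rewrite expr2 -mulNr fcoef0_mulX.
Qed.

Lemma egf_seq_hermite_series r n :
  egf_seq hermite_series n *+ 2 ^ r =
  \sum_(k < n.+1) (2 ^+ k * egf_seq (euler_series r) k) *
    (\sum_(j < r.+1) ev j (egf_seq hermite_series (n - k)) *+ 'C(r, j))
      *+ 'C(n, k).
Proof.
rewrite /egf_seq -mulrnAl -fcoefMn -[_ *+ 2 ^ r]mulr_natl natrX.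
rewrite hermite_series_euler_series fcoefM mulr_suml; apply: eq_bigr => k _.
have lekn : (k <= n)%N by rewrite -ltnS.
(* Splitting $n! = \binom{n}{k} k! (n-k)!$ gives each of the two factors the factorial that
   [egf_seq] requires. *)
rewrite fcoef_sum -(bin_fact lekn) !natrM fcoef_scale.
have -> : \sum_(j < r.+1) ev j (fcoef hermite_series (n - k) * (n - k)`!%:R)
      *+ 'C(r, j) =
    (\sum_(j < r.+1) fcoef (fps_map (ev j) hermite_series *+ 'C(r, j)) (n - k))
      * (n - k)`!%:R.
  rewrite [RHS]mulr_suml; apply: eq_bigr => j _.
  by rewrite rmorphM rmorph_nat fcoefMn mulrnAl.
rewrite -[RHS]mulr_natl [LHS]mulrCA; congr (_ * _).
by rewrite mulrACA !mulrA.
Qed.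
End Identity.

(** * Return to polynomials over [F] *)

Lemma hermite_euler (F : numFieldType) r n :
  hermite F n *+ 2 ^ r =
  \sum_(k < n.+1) (2 ^+ k * euler F r k) *
    (\sum_(j < r.+1) ((hermite F (n - k)).[j%:R])%:P *+ 'C(r, j))
      *+ 'C(n, k).
Proof.
(* The value at [j] is embedded back as a constant polynomial, because [ev j] has to be an
   endomorphism of the coefficient ring. *)
pose ev (j : nat) : {rmorphism {poly F} -> {poly F}} :=
  polyC \o horner_eval (j%:R : F).
have ev_x j : ev j 'X = j%:R by rewrite /= /horner_eval hornerX polyC_natr.
exact: (@egf_seq_hermite_series _ 'X (@polyC_fact_unit F) ev ev_x r n).
Qed.

Theorem theorem5 (F : numFieldType) (r n : nat) :
  hermite F n =
    (2 ^+ r)^-1 *: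
      \sum_(k < n.+1)
        ('C(n, k)%:R * 2 ^+ k *
         (\sum_(j < r.+1) 'C(r, j)%:R * (hermite F (n - k)).[j%:R]))
        *: euler F r k.
Proof.
have r2 : (2 ^+ r : F) != 0 by rewrite expf_neq0 // Num.Theory.pnatr_eq0.
apply: (scalerI r2); rewrite scalerA divff // scale1r.
rewrite -natrX scaler_nat hermite_euler; apply: eq_bigr => k _.
(* The inner sum is a constant polynomial, so it can act as a scalar on the Euler polynomial. *)
have <- : (\sum_(j < r.+1) 'C(r, j)%:R * (hermite F (n - k)).[j%:R])%:P =
    \sum_(j < r.+1) ((hermite F (n - k)).[j%:R])%:P *+ 'C(r, j).
  by rewrite rmorph_sum; apply: eq_bigr => j _; rewrite mulr_natl /= polyCMn.
set S := \sum_(j < r.+1) _; move: (euler F r k) => E.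
rewrite -mul_polyC !polyCM polyC_exp !polyC_natr -mulr_natl -!mulrA.
by rewrite [S%:P * _]mulrC.
Qed.
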